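(* Let $\mathcal R$ be a unital ring, let $M$ be a right $\mathcal R$-module with $Th(M)=Th(M)^{\aleph_0}$, let $n\ge1$ and $a\in M^n$. For all finite antichains $\alpha,\beta\in\mathcal A$ of nonempty pp-subsets of $M^n$, $$\kappa_a(\alpha\vee\beta)+\kappa_a(\alpha\wedge\beta)=\kappa_a(\alpha)+\kappa_a(\beta).$$
   Context: **pp-sets.** A right $\mathcal R$-module $M$ is viewed as a first order structure in the language $\langle 0,+,-,m_r: r\in\mathcal R\rangle$. A pp-formula is a formula equivalent to one of the form $\exists y_1\dots\exists y_m\bigwedge_{i=1}^t\left(\sum_j x_jr_{ij}+\sum_k y_ks_{ik}+c_i=0\right)$ with $r_{ij},s_{ik}\in\mathcal R$ and parameters $c_i\in M$. A pp-set is a subset of $M^n$ defined by a pp-formula; it is empty or a coset of a subgroup of $M^n$ defined by a parameter-free pp-formula (a pp-definable subgroup). $\mathcal L$ is the set of pp-subsets of $M^n$ ($n$ fixed). **The condition $Th(M)=Th(M)^{\aleph_0}$** means $M\equiv M^{(\aleph_0)}$; equivalently, for every $m\ge1$ and all pp-definable subgroups $A,B$ of $M^m$, the index $[A:A\cap B]$ is $1$ or infinite. In particular a pp-set is finite iff it has at most one element. **Antichains.** $\mathcal A$ is the set of finite antichains (with respect to inclusion) in $\mathcal L\setminus\{\emptyset\}$. A set is pp-convex if it is a finite union of nonempty pp-sets; under the condition $Th(M)=Th(M)^{\aleph_0}$ each pp-convex set equals $\bigcup\alpha$ for a unique $\alpha\in\mathcal A$. Unions and intersections of two pp-convex sets are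 pp-convex; $\alpha\vee\beta$ and $\alpha\wedge\beta$ denote the unique antichains in $\mathcal A$ with $\bigcup(\alpha\vee\beta)=(\bigcup\alpha)\cup(\bigcup\beta)$ and $\bigcup(\alpha\wedge\beta)=(\bigcup\alpha)\cap(\bigcup\beta)$. **Local characteristic.** For $\alpha$ a finite set of nonempty pp-subsets of $M^n$, let $\mathcal N_a(\alpha):=\{A\in\alpha: a\in A\}$. Let $\mathcal K^a(\mathcal N_a(\alpha))$ be the abstract simplicial complex with vertex set $\mathcal N_a(\alpha)\setminus\{\{a\}\}$ whose faces are the nonempty sets $\gamma\subseteq\mathcal N_a(\alpha)$ such that $\bigcap\gamma$ is infinite (equivalently, strictly contains $\{a\}$); it may be empty. The Euler characteristic is $\chi(\mathcal K)=\sum_{k\ge0}(-1)^kv_k$, $v_k$ being the number of faces with $k+1$ elements, and $\chi(\emptyset)=0$. Let $\delta(\alpha)(a)=1$ if $a\in\bigcup\alpha$ and $0$ otherwise. Then $\kappa_a(\alpha):=\chi(\mathcal K^a(\mathcal N_a(\alpha)))-\delta(\alpha)(a)\in\mathbb Z$. *)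

(* Defs.v *)
From HB Require Import structures.
From mathcomp Require Import all_boot all_order all_algebra finmap.
From mathcomp Require Import all_classical.

Set Implicit Arguments.
Unset Strict Implicit.
Unset Printing Implicit Defensive.

Import GRing.Theory.
Local Open Scope ring_scope.

(* A right R-module is an lmodType over the converse ring R^c; the right
   action is the left action of R^c, so that (x .* r) .* s = x .* (r * s). *)
Definition rscale (R : pzRingType) (M : lmodType R^c) (x : M) (r : R) : M :=
  (r : R^c) *: x.

Notation "x .* r" := (rscale x r)
  (at level 40, left associativity, format "x  .* r") : ring_scope.

Lemma rscaleA (R : pzRingType) (M : lmodType R^c) (x : M) (r s : R) :
  (x .* r) .* s = x .* (r * s).
Proof. by rewrite /rscale scalerA. Qed.

(* First-order logic in the language <0, +, -, m_r : r in R>.  Variables are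
   named by natural numbers; Tscale t r is m_r applied to t. *)
Inductive mterm (R : Type) : Type :=
| Tvar of nat
| Tzero
| Tadd of mterm R & mterm R
| Topp of mterm R
| Tscale of mterm R & R.

Inductive mformula (R : Type) : Type :=
| Feq of mterm R & mterm R
| Fnot of mformula R
| Fand of mformula R & mformula R
| Fexists of nat & mformula R.

Arguments Tvar {R}.
Arguments Tzero {R}.

Fixpoint term_vars (R : Type) (t : mterm R) : seq nat :=
  match t with
  | Tvar i => [:: i]
  | Tzero => [::]
  | Tadd t1 t2 => term_vars t1 ++ term_vars t2
  | Topp t1 => term_vars t1
  | Tscale t1 _ => term_vars t1
  end.

Fixpoint free_vars (R : Type) (f : mformula R) : seq nat :=
  match f with
  | Feq t1 t2 => term_vars t1 ++ term_vars t2
  | Fnot f1 => free_vars f1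
  | Fand f1 f2 => free_vars f1 ++ free_vars f2
  | Fexists i f1 => [seq j <- free_vars f1 | j != i]
  end.

Definition sentence (R : Type) (f : mformula R) : Prop := free_vars f = [::].

Section Satisfaction.
Variables (R : pzRingType) (M : lmodType R^c).

Fixpoint term_eval (e : nat -> M) (t : mterm R) : M :=
  match t with
  | Tvar i => e i
  | Tzero => 0
  | Tadd t1 t2 => term_eval e t1 + term_eval e t2
  | Topp t1 => - term_eval e t1
  | Tscale t1 r => term_eval e t1 .* r
  end.

Fixpoint sat (e : nat -> M) (f : mformula R) : Prop :=
  match f with
  | Feq t1 t2 => term_eval e t1 = term_eval e t2
  | Fnot f1 => ~ sat e f1
  | Fand f1 f2 => sat e f1 /\ sat e f2
  | Fexists i f1 => exists x : M, sat (fun j => if j == i then x else e j) f1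
  end.

(* The assignment is irrelevant when f is a sentence. *)
Definition models (f : mformula R) : Prop := forall e : nat -> M, sat e f.

End Satisfaction.

Definition elementarily_equivalent (R : pzRingType) (M N : lmodType R^c) :
    Prop :=
  forall f : mformula R, sentence f -> (models M f <-> models N f).

(* The direct sum M^(aleph_0), as the submodule of finitely supported
   sequences in the module nat -> M of all sequences. *)
Section DirectSum.
Variables (S : pzRingType) (M : lmodType S).

Definition finitely_supported : {pred (nat -> M)} :=
  [pred f : nat -> M | `[< finite_set [set i | f i != 0] >]].

Fact finitely_supported_submod_closed :
  GRing.submod_closed finitely_supported.
Proof.
split=> [|c f g /asboolP ff /asboolP fg]; apply/asboolP.
  rewrite (_ : [set i | _] = set0)%classic ?finite_set0 //.
  by rewrite -subset0 => i /=; rewrite eqxx.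
apply: (@sub_finite_set _ _
  ([set i | f i != 0%R] `|` [set i | g i != 0%R])%classic);
  last by rewrite finite_setU.
move=> i /=; rewrite !fctE; have [->|] := eqVneq (f i) 0; last by left.
by rewrite scaler0 add0r; right.
Qed.

HB.instance Definition _ :=
  GRing.isSubmodClosed.Build S (nat -> M) finitely_supported
    finitely_supported_submod_closed.

Record direct_sum_omega : Type := DirectSumOmega {
  dsum_val :> nat -> M;
  dsum_valP : dsum_val \in finitely_supported
}.

HB.instance Definition _ := [isSub for dsum_val].
HB.instance Definition _ := [Choice of direct_sum_omega by <:].
HB.instance Definition _ :=
  [SubChoice_isSubLmodule of direct_sum_omega by <:].

End DirectSum.

Definition theory_eq_aleph0 (R : pzRingType) (M : lmodType R^c) : Prop :=
  elementarily_equivalent M (direct_sum_omega M).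

Definition simplicial_euler_char (V : choiceType) (K : {fset {fset V}}) : int :=
  \sum_(0 <= k < \max_(F <- K) #|` F|)
    (-1) ^+ k * (#|` [fset F in K | #|` F| == k.+1]%fset|)%:Z.

Section PPSets.
Variables (R : pzRingType) (M : lmodType R^c) (n : nat).

Local Notation Mn := {ffun 'I_n -> M}.
Local Open Scope classical_set_scope.

Definition pp_set (A : set Mn) : Prop :=
  exists (m t : nat) (r : 'M[R]_(t, n)) (s : 'M[R]_(t, m)) (c : 'I_t -> M),
    A = [set x : Mn | exists y : {ffun 'I_m -> M}, forall i : 'I_t,
          \sum_(j < n) x j .* r i j + \sum_(k < m) y k .* s i k + c i = 0].

Definition pp_antichain (alpha : {fset set Mn}) : Prop :=
  (forall A, A \in alpha -> pp_set A /\ A !=set0) /\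
  (forall A B, A \in alpha -> B \in alpha -> A `<=` B -> A = B).

Definition pp_union (alpha : {fset set Mn}) : set Mn :=
  \bigcup_(A in [set` alpha]) A.

(* When M is elementarily equivalent to M^(aleph_0), the antichains
   specified in pp_join and pp_meet exist and are unique; the default value
   fset0 of xget is then never used. *)
Definition pp_join (alpha beta : {fset set Mn}) : {fset set Mn} :=
  xget fset0 [set gamma | pp_antichain gamma /\
                          pp_union gamma = pp_union alpha `|` pp_union beta].

Definition pp_meet (alpha beta : {fset set Mn}) : {fset set Mn} :=
  xget fset0 [set gamma | pp_antichain gamma /\
                          pp_union gamma = pp_union alpha `&` pp_union beta].

Definition members_at (a : Mn) (alpha : {fset set Mn}) : {fset set Mn} :=
  [fset A in alpha | `[< A a >]]%fset.

Definition local_complex (a : Mn) (alpha : {fset set Mn}) :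
    {fset {fset set Mn}} :=
  [fset gamma in fpowerset (members_at a alpha `\ [set a])%fset
     | (gamma != fset0) && `[< infinite_set (\bigcap_(A in [set` gamma]) A) >]
  ]%fset.

Definition delta (alpha : {fset set Mn}) (a : Mn) : int :=
  if `[< pp_union alpha a >] then 1 else 0.

Definition local_char (a : Mn) (alpha : {fset set Mn}) : int :=
  simplicial_euler_char (local_complex a alpha) - delta alpha a.

End PPSets.

(* Main.v *)
(* The faces of the local complex at [a] are the nonempty sets [gamma] of
   members through [a] whose intersection satisfies the predicate "infinite".
   Moebius inversion on a finite family [F] of pp-sets through [a] writes this
   predicate as [Q |-> \sum_(P in F, P `<=` Q) g P].  Inclusion-exclusion over
   [gamma] then turns the Euler characteristic into the sum of [g P] over the
   [P] in [F] contained in a single member of [alpha].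

   When [M] is elementarily equivalent to M^(aleph_0), a nonempty pp-set covered
   by finitely many pp-sets lies in one of them, so the condition on [P] becomes
   [P `<=` pp_union alpha].  By the same primality the indicator of this
   condition is a valuation on pp-convex sets, and [delta] trivially is one.

   Primality needs no covering lemma for cosets: if the pp-subgroup [P] lies in
   none of the pp-subgroups [D l], then M^(aleph_0) contains, for every [K], [K]
   elements of [P] pairwise incongruent modulo every [D l].  This is a
   first-order sentence, hence true in [M], and the pigeonhole principle
   applies. *)
Require Import Defs.
From HB Require Import structures.
From mathcomp Require Import all_boot all_order all_algebra finmap.
From mathcomp Require Import all_classical.

Set Implicit Arguments.
Unset Strict Implicit.
Unset Printing Implicit Defensive.

Import GRing.Theory.
Local Open Scope ring_scope.

(** * Pp-definable subgroups and their first-order formulas *)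

Section Formulas.
Variable R : pzRingType.
Implicit Types (t : mterm R) (f : mformula R) (M N : lmodType R^c).

Definition Ftrue : mformula R := Feq Tzero Tzero.
Definition Fexs (l : seq nat) f : mformula R := foldr (@Fexists R) f l.

Lemma free_vars_Fexs l f :
  free_vars (Fexs l f) = [seq j <- free_vars f | j \notin l].
Proof.
elim: l => [|i l IHl] /=; first by rewrite filter_predT.
rewrite IHl -filter_predI; apply: eq_filter => j /=.
by rewrite inE negb_or.
Qed.

Lemma sat_Fexs M (e : nat -> M) l f :
  sat e (Fexs l f) <->
  exists2 e' : nat -> M, (forall j, j \notin l -> e' j = e j) & sat e' f.
Proof.
elim: l e => [|i l IHl] e /=.
  split=> [|[e' ee' fe']]; first by exists e.
  by rewrite (_ : e = e') //; apply/funext => j; rewrite ee'.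
split=> [[x /IHl[e' ee' fe']]|[e' ee' fe']].
  exists e' => // j; rewrite inE negb_or => /andP[ji jl].
  by rewrite ee' // (negPf ji).
exists (e' i); apply/IHl; exists e' => // j jl.
by case: eqVneq => [->|ji] //; rewrite ee' // inE negb_or ji.
Qed.

Lemma sat_bigand M (e : nat -> M) (I : finType) (P : pred I)
    (F : I -> mformula R) :
  sat e (\big[@Fand R/Ftrue]_(i | P i) F i) <-> forall i, P i -> sat e (F i).
Proof.
suff H (r : seq I) : sat e (\big[@Fand R/Ftrue]_(i <- r | P i) F i) <->
    forall i, i \in r -> P i -> sat e (F i).
  rewrite H; split=> He i; last by move=> _; apply: He.
  by apply: He; rewrite mem_index_enum.
elim: r => [|j r IHr]; first by rewrite big_nil.
rewrite big_cons; case: ifP => Pj /=.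
  rewrite IHr; split=> [[Fj Fr] i|He].
    by rewrite inE => /orP[/eqP->|/Fr].
  by split=> [|i ir]; apply: He; rewrite // inE ?eqxx ?ir ?orbT.
rewrite IHr; split=> He i.
  by rewrite inE => /orP[/eqP->|/He//]; rewrite Pj.
by move=> ir; apply: He; rewrite inE ir orbT.
Qed.

Lemma term_eval_eq M (e e' : nat -> M) t :
  {in term_vars t, e =1 e'} -> term_eval e t = term_eval e' t.
Proof.
elim: t => //= [i|t1 IH1 t2 IH2|t1 IH1|t1 IH1 r] ee'.
- by apply: ee'; rewrite inE.
- by rewrite IH1 ?IH2 // => j jt; apply: ee'; rewrite mem_cat jt ?orbT.
- by rewrite IH1.
- by rewrite IH1.
Qed.

Lemma term_eval_sum M (e : nat -> M) (I : finType) (F : I -> mterm R) :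
  term_eval e (\big[@Tadd R/Tzero]_i F i) = \sum_i term_eval e (F i).
Proof. exact: (big_morph (term_eval e)). Qed.

Variable n : nat.

(* The homogeneous system [\sum_j x_j r_ij + \sum_k y_k s_ik = 0] defining a
   pp-definable subgroup. *)
Record pp_system : Type := PPSystem {
  pp_witnesses : nat;
  pp_equations : nat;
  pp_coef : 'M[R]_(pp_equations, n);
  pp_wcoef : 'M[R]_(pp_equations, pp_witnesses)
}.

Implicit Type S : pp_system.

(** The module is left variable so that one system can be read both in [M] and in its direct sum. *)
Definition pp_solution M S (x : 'I_n -> M) : Prop :=
  exists y : 'I_(pp_witnesses S) -> M, forall i : 'I_(pp_equations S),
    \sum_j x j .* pp_coef S i j + \sum_k y k .* pp_wcoef S i k = 0.

Lemma pp_solution0 M S : pp_solution S (fun=> 0 : M).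
Proof.
exists (fun=> 0) => i.
by rewrite !big1 ?addr0 // => j _; rewrite /rscale scaler0.
Qed.

Lemma pp_solutionB M S (x x' : 'I_n -> M) :
  pp_solution S x -> pp_solution S x' -> pp_solution S (fun j => x j - x' j).
Proof.
move=> [y xy] [y' xy']; exists (fun k => y k - y' k) => i.
have := congr2 (fun u v => u - v) (xy i) (xy' i).
rewrite subr0 opprD addrACA -!sumrB => xyB; rewrite -[RHS]xyB.
by congr (_ + _); apply: eq_bigr => j _; rewrite /rscale scalerBr.
Qed.

Lemma pp_solution_sum M S (I : finType) (x : I -> 'I_n -> M) :
  (forall i, pp_solution S (x i)) -> pp_solution S (fun j => \sum_i x i j).
Proof.
move=> xS; suff H (r : seq I) : pp_solution S (fun j => \sum_(i <- r) x i j).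
  exact: H.
elim: r => [|i r IHr].
  rewrite (_ : (fun _ => _) = (fun=> 0)); first exact: pp_solution0.
  by apply/funext => j; rewrite big_nil.
have := pp_solutionB (xS i) (pp_solutionB (pp_solution0 M S) IHr).
congr (pp_solution S _); apply/funext => j.
by rewrite big_cons sub0r opprK.
Qed.

(** Linear maps carry witnesses to witnesses; this serves for the injections into the direct sum and
    the projections out of it. *)
Lemma pp_solution_map M N S (h : {linear M -> N}) (x : 'I_n -> M) :
  pp_solution S x -> pp_solution S (fun j => h (x j)).
Proof.
move=> [y xy]; exists (fun k => h (y k)) => i.
have := congr1 h (xy i); rewrite linear0 linearD !linear_sum => hxy; rewrite -[RHS]hxy.
by congr (_ + _); apply: eq_bigr => j _; rewrite linearZ.
Qed.

(* The witnesses are named [b, b + 1, ...], so [b] must bound the variables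
   of the terms [tau j]. *)
Definition pp_formula (b : nat) (tau : 'I_n -> mterm R) S : mformula R :=
  Fexs (iota b (pp_witnesses S)) (\big[@Fand R/Ftrue]_(i < pp_equations S)
    Feq (Tadd (\big[@Tadd R/Tzero]_j Tscale (tau j) (pp_coef S i j))
           (\big[@Tadd R/Tzero]_(k < pp_witnesses S)
              Tscale (Tvar (b + k)) (pp_wcoef S i k))) Tzero).

Lemma free_vars_pp_formula b tau S :
  (forall j, all (gtn b) (term_vars (tau j))) ->
  all (gtn b) (free_vars (pp_formula b tau S)).
Proof.
move=> tau_b; rewrite free_vars_Fexs all_filter.
set f := \big[_/_]_i _.
suff: all (gtn (b + pp_witnesses S)) (free_vars f).
  apply: sub_all => j /= jb; apply/implyP; rewrite mem_iota negb_and jb orbF.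
  by rewrite ltnNge.
apply: (big_ind (fun g => all (gtn (b + pp_witnesses S)) (free_vars g))) => //.
  by move=> f1 f2 /=; rewrite all_cat => -> ->.
move=> i _ /=; rewrite cats0 all_cat; apply/andP; split.
  apply: (big_ind (fun t => all (gtn (b + pp_witnesses S)) (term_vars t))) => //.
    by move=> t1 t2 /=; rewrite all_cat => -> ->.
  move=> j _ /=; apply: sub_all (tau_b j) => k /= kb.
  exact: leq_trans kb (leq_addr _ _).
apply: (big_ind (fun t => all (gtn (b + pp_witnesses S)) (term_vars t))) => //.
  by move=> t1 t2 /=; rewrite all_cat => -> ->.
by move=> k _ /=; rewrite andbT ltn_add2l.
Qed.

Lemma sat_pp_formula M (e : nat -> M) b tau S :
  (forall j, all (gtn b) (term_vars (tau j))) ->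
  sat e (pp_formula b tau S) <-> pp_solution S (fun j => term_eval e (tau j)).
Proof.
move=> tau_b; rewrite sat_Fexs.
have tauE (e' : nat -> M) j :
    (forall k, k \notin iota b (pp_witnesses S) -> e' k = e k) ->
  term_eval e' (tau j) = term_eval e (tau j).
  move=> ee'; apply: term_eval_eq => k /(allP (tau_b j)) /= kb.
  by rewrite ee' // mem_iota negb_and -ltnNge kb.
split=> [[e' ee' /sat_bigand fe']|[y xy]].
  exists (fun k => e' (b + k)%N) => i.
  have /= := fe' i isT; rewrite !term_eval_sum /= => fi; rewrite -[RHS]fi.
  by congr (_ + _); apply: eq_bigr => j _; rewrite tauE.
(* Subtraction on [nat] truncates, so [k < b] gives [k - b = 0]; the test [b <= k] keeps such a
   variable from being read as the first witness. *)
pose e' k := if insub (k - b)%N is Some j then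
  if (b <= k)%N then y j else e k else e k.
have ee' k : k \notin iota b (pp_witnesses S) -> e' k = e k.
  rewrite mem_iota negb_and /e'; case: insubP => // j jk _.
  by case: (leqP b k) => //= bk; rewrite -ltn_subLR // jk.
exists e' => //; apply/sat_bigand => i _ /=; rewrite !term_eval_sum /= -[RHS](xy i).
congr (_ + _); apply: eq_bigr => j _; first by rewrite tauE.
rewrite /e' addKn leq_addr; case: insubP => [k _ kj|]; last by rewrite ltn_ord.
by congr (y _ .* _); apply: val_inj.
Qed.

End Formulas.

(** * Coordinate projections and injections of the direct sum *)

Section DirectSumCoordinates.
Variables (S : pzRingType) (M : lmodType S).
Local Notation N := (direct_sum_omega M).

Definition dsum_coord (c : nat) (x : N) : M := dsum_val x c.

Fact dsum_coord_linear c : linear (dsum_coord c).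
Proof. by []. Qed.

HB.instance Definition _ c :=
  GRing.isLinear.Build S N M *:%R (dsum_coord c) (dsum_coord_linear c).

Fact dsum_single_supported (c : nat) (x : M) :
  (fun d : nat => if d == c then x else 0) \in @finitely_supported S M.
Proof.
apply/asboolP; apply: (@sub_finite_set _ _ [set c]%classic) => // d /=.
by case: (eqVneq d c) => // _; rewrite eqxx.
Qed.

Definition dsum_single c x : N := DirectSumOmega (dsum_single_supported c x).

Fact dsum_single_linear c : linear (dsum_single c).
Proof.
move=> u x y; apply: val_inj; apply/funext => d /=.
rewrite -[RHS]/(u *: (if d == c then x else 0) + (if d == c then y else 0)).
by case: eqP => // _; rewrite scaler0 addr0.
Qed.

HB.instance Definition _ c :=
  GRing.isLinear.Build S M N *:%R (dsum_single c) (dsum_single_linear c).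

End DirectSumCoordinates.

(** * Transfer of incongruent tuples from the direct sum to the module *)

Section Independence.
Variables (R : pzRingType) (n : nat) (I : finType) (D : I -> pp_system R n).
Variables (P : pp_system R n) (K : nat).

Definition spread_in (M : lmodType R^c) : Prop :=
  exists x : 'I_K -> 'I_n -> M, (forall i, pp_solution P (x i)) /\
    forall i i' l, i != i' -> ~ pp_solution (D l) (fun j => x i j - x i' j).

(** Entry [j] of tuple [i] is the variable [i * n + j], so all entries lie below [K * n]. Each
    conjunct quantifies its own witnesses, so all can use the names from [b] on. *)
Definition spread_body : mformula R :=
  let b := (K * n)%N in
  Fand (\big[@Fand R/Ftrue R]_(i < K)
          pp_formula b (fun j => Tvar (i * n + j)) P)
       (\big[@Fand R/Ftrue R]_(q : 'I_K * 'I_K * I | q.1.1 != q.1.2)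
          Fnot (pp_formula b
            (fun j => Tadd (Tvar (q.1.1 * n + j)) (Topp (Tvar (q.1.2 * n + j))))
            (D q.2))).

Definition spread_formula : mformula R := Fexs (iota 0 (K * n)) spread_body.

Lemma spread_var (i : 'I_K) (j : 'I_n) : (i * n + j < K * n)%N.
Proof.
apply: (@leq_trans (i.+1 * n)); first by rewrite mulSn addnC ltn_add2r.
by rewrite leq_mul2r ltn_ord orbT.
Qed.

Lemma sentence_spread : sentence spread_formula.
Proof.
rewrite /sentence free_vars_Fexs; apply/eqP; rewrite -(negbK (_ == _)) -has_filter.
rewrite -all_predC; set f := spread_body.
suff: all (gtn (K * n)) (free_vars f).
  by apply: sub_all => j /= jKn; rewrite mem_iota /= negbK.
rewrite /= all_cat; apply/andP; split.
  apply: (big_ind (fun g => all (gtn (K * n)) (free_vars g))) => //.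
    by move=> f1 f2 /=; rewrite all_cat => -> ->.
  by move=> i _; apply: free_vars_pp_formula => j /=; rewrite spread_var.
apply: (big_ind (fun g => all (gtn (K * n)) (free_vars g))) => //.
  by move=> f1 f2 /=; rewrite all_cat => -> ->.
by move=> q _; apply: free_vars_pp_formula => j /=; rewrite !spread_var.
Qed.

Lemma sat_spread (M : lmodType R^c) (e : nat -> M) :
  sat e spread_formula <-> spread_in M.
Proof.
rewrite sat_Fexs; split=> [[e' _ [/sat_bigand eP /sat_bigand eD]]|[x [xP xD]]].
  exists (fun i j => e' (i * n + j)%N); split=> [i|i i' l ii'].
    have := eP i isT; rewrite sat_pp_formula // => j /=.
    by rewrite spread_var.
  have /= := eD (i, i', l) ii'; rewrite sat_pp_formula // => j /=.
  by rewrite !spread_var.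
(* A variable is decoded by division by [n]. From [K * n] on one of the two [insub] fails, the
   second one when [n = 0], and [e] is kept. *)
pose e' k := if insub (k %/ n)%N is Some i then
  if insub (k %% n)%N is Some j then x i j else e k else e k.
have e'E (i : 'I_K) (j : 'I_n) : e' (i * n + j)%N = x i j.
  have n0 : (0 < n)%N by apply: leq_ltn_trans (ltn_ord j).
  rewrite /e' divnMDl // divn_small // addn0 modnMDl modn_small //.
  by rewrite !valK.
exists e' => [k|].
  rewrite mem_iota /= -leqNgt /e' => kKn; case: insubP => // i iK ik.
  case: insubP => // j jn _; have n0 := leq_ltn_trans (leq0n _) jn.
  by move: iK; rewrite ltn_divLR // ltnNge kKn.
split; apply/sat_bigand => /=.
  move=> i _; apply/sat_pp_formula => /= [j|]; first by rewrite spread_var.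
  by have := xP i; congr (pp_solution P _); apply/funext => j; rewrite e'E.
move=> [[i i'] l] /= ii'; rewrite sat_pp_formula => /= [|j]; last first.
  by rewrite !spread_var.
have := xD i i' l ii'; congr (~ pp_solution _ _); apply/funext => j.
by rewrite !e'E.
Qed.

(* For each pair [(i, l)] a fresh coordinate of the [i]-th tuple holds a
   solution of [P] that does not solve [D l]. *)
Lemma spread_dsum (M : lmodType R^c) :
  (forall l, exists2 z : 'I_n -> M, pp_solution P z & ~ pp_solution (D l) z) ->
  spread_in (direct_sum_omega M).
Proof.
move=> /(_ _)/cid2-/all_sig2[z zP zD].
pose c (i : 'I_K) (l : I) : nat := enum_rank (i, l).
exists (fun i j => \sum_l dsum_single (c i l) (z l j)); split=> [i|i i' l ii' xD].
  by apply: pp_solution_sum => l; apply: pp_solution_map.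
(* Since [enum_rank] is injective and [i != i'], only [z l] survives at the coordinate [c i l] of
   the difference. *)
apply: (zD l); have := pp_solution_map (dsum_coord (c i l)) xD.
congr (pp_solution _ _); apply/funext => j.
rewrite linearB !linear_sum /= (bigD1 l) //= eqxx.
rewrite !big1 ?addr0 // => l' ll'; case: eqP => [/val_inj/enum_rank_inj[]|_].
- by move=> ii'E; rewrite ii'E eqxx in ii'.
- by rewrite oppr0.
- by move=> ll'E; rewrite ll'E eqxx in ll'.
- by [].
Qed.

Lemma spread_exists (M : lmodType R^c) :
  theory_eq_aleph0 M ->
  (forall l, exists2 z : 'I_n -> M, pp_solution P z & ~ pp_solution (D l) z) ->
  spread_in M.
Proof.
move=> hM hD; have [_ NM] := hM _ sentence_spread.
apply/(sat_spread (fun=> 0)); apply: NM => e.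
by apply/sat_spread; apply: spread_dsum.
Qed.

End Independence.

Local Open Scope classical_set_scope.

(** * Pp-sets as cosets, their primality and their intersections *)

Section PPSets.
Variables (R : pzRingType) (M : lmodType R^c) (n : nat).
Local Notation Mn := {ffun 'I_n -> M}.
Implicit Types A B P : set Mn.

(** Parameters cancel in the difference of two solutions, so [A] is a coset of the solutions of the
    homogeneous system, which is the same for every base point [b]. *)
Lemma pp_set_system A : pp_set A ->
  exists S : pp_system R n, forall b x, A b ->
    (A x <-> pp_solution S (fun j => x j - b j)).
Proof.
move=> [m [t [r [s [c ->]]]]]; exists (PPSystem r s) => b x /= [y yb].
split=> [[y' y'x]|[y' y'x]].
  exists (fun k => y' k - y k) => i /=.
  have /= := congr2 (fun u v => u - v) (y'x i) (yb i).
  rewrite subr0 opprD addrACA subrr addr0 opprD addrACA -!sumrB => xyB; rewrite -[RHS]xyB.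
  by congr (_ + _); apply: eq_bigr => j _; rewrite /rscale scalerBr.
exists [ffun k => y' k + y k] => i.
have /= := congr2 (fun u v => u + v) (y'x i) (yb i).
rewrite addr0 addrA addrACA -!big_split /= => xyD; rewrite -[RHS]xyD.
congr (_ + _ + _); apply: eq_bigr => j _; rewrite ?ffunE /rscale -scalerDr //.
by rewrite subrK.
Qed.

(* If [P] lies in no member, the subgroup of [P] contains tuples, as many as
   wanted, that are pairwise incongruent modulo the subgroup of every member
   meeting [P]; by the pigeonhole principle their translates in [P] cannot be
   covered. *)
Lemma pp_set_prime (hM : theory_eq_aleph0 M) P (alpha : {fset set Mn}) :
  pp_set P -> P !=set0 -> (forall A, A \in alpha -> pp_set A) ->
  P `<=` pp_union alpha -> exists2 A, A \in alpha & P `<=` A.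
Proof.
move=> ppP [p Pp] ppalpha Palpha; apply: contrapT => noA.
have [S PS] := pp_set_system ppP.
(* A member disjoint from [P] must be dropped: its subgroup may contain that of [P]. *)
pose alpha' := [fset A in alpha | `[< (A `&` P) !=set0 >]]%fset.
have {}ppalpha (A : alpha') : exists D : pp_system R n, forall b x, \val A b ->
    (\val A x <-> pp_solution D (fun j => x j - b j)).
  apply: pp_set_system; apply: ppalpha.
  by have := valP A; rewrite !inE => /andP[].
have [D AD] := choice ppalpha.
have [|x [xP xD]] := @spread_exists R n alpha' D S #|{: alpha'}|.+1 M hM.
  (* For [b] in both sets and [x] in [P] outside [A], the difference [x - b] lies in the subgroup of
     [P] but not in that of [A]. *)
  move=> A; have := valP A; rewrite !inE => /andP[Aalpha /asboolP[b [Ab Pb]]].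
  have [x Px nAx] : exists2 x, P x & ~ \val A x.
    apply: contrapT => nx; apply: noA; exists (\val A) => // x Px.
    by apply: contrapT => nAx; apply: nx; exists x.
  by exists (fun j => x j - b j); [apply/PS | move/AD => /(_ Ab)].
pose q i : Mn := [ffun j => p j + x i j].
have Pq i : P (q i).
  apply/(PS p) => //; have := xP i; congr (pp_solution _ _).
  by apply/funext => j; rewrite ffunE addrC addKr.
have /choice[f qf] i : exists A : alpha', \val A (q i).
  have [A /= Aalpha Aq] := Palpha _ (Pq i).
  have Aa' : A \in alpha' by rewrite !inE Aalpha; apply/asboolP; exists (q i).
  by exists [` Aa']%fset.
have /injectivePn[i [i' ii' fii']] : ~~ injectiveb f.
  by apply/negP => /injectiveP/leq_card; rewrite card_ord ltnn.
apply: (xD i i' (f i) ii'); have := qf i; rewrite (AD (f i) (q i')); last first.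
  by rewrite fii'.
congr (pp_solution _ _); apply/funext => j.
by rewrite !ffunE opprD addrACA subrr add0r.
Qed.

Lemma pp_setT : pp_set [set: Mn].
Proof.
exists 0%N, 0%N, 0, 0, (fun=> 0); apply/seteqP; split=> // x _ /=.
by exists [ffun=> 0] => -[].
Qed.

(** The two systems are stacked; the block diagonal witness matrix keeps their witnesses
    separate. *)
Lemma pp_setI A B : pp_set A -> pp_set B -> pp_set (A `&` B).
Proof.
move=> [m [t [r [s [c ->]]]]] [m' [t' [r' [s' [c' ->]]]]].
exists (m + m')%N, (t + t')%N, (col_mx r r'), (block_mx s 0 0 s').
exists (fun i => match fintype.split i with inl i => c i | inr i => c' i end).
apply/seteqP; split=> [x [[y xy] [y' xy']]|x [y xy]] /=.
  exists [ffun k => match fintype.split k with inl k => y k | inr k => y' k end] => i.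
  rewrite big_split_ord /= -[i]splitK; case: (fintype.split i) => {}i.
    rewrite unsplitK -[RHS](xy i) /=; congr (_ + _ + _).
      by apply: eq_bigr => j _; rewrite col_mxEu.
    rewrite [X in _ + X]big1 ?addr0 => [|k _]; last first.
      by rewrite block_mxEur mxE /rscale scale0r.
    by apply: eq_bigr => k _; rewrite block_mxEul ffunE (unsplitK (inl k)).
  rewrite unsplitK -[RHS](xy' i) /=; congr (_ + _ + _).
    by apply: eq_bigr => j _; rewrite col_mxEd.
  rewrite [X in X + _]big1 ?add0r => [|k _]; last first.
    by rewrite block_mxEdl mxE /rscale scale0r.
  by apply: eq_bigr => k _; rewrite block_mxEdr ffunE (unsplitK (inr k)).
split.
  exists [ffun k => y (lshift m' k)] => i; rewrite -[RHS](xy (lshift t' i)).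
  rewrite big_split_ord /= (unsplitK (inl i)); congr (_ + _ + _).
    by apply: eq_bigr => j _; rewrite col_mxEu.
  rewrite [X in _ + X]big1 ?addr0 => [|k _]; last first.
    by rewrite block_mxEur mxE /rscale scale0r.
  by apply: eq_bigr => k _; rewrite block_mxEul ffunE.
exists [ffun k => y (rshift m k)] => i; rewrite -[RHS](xy (rshift t i)).
rewrite big_split_ord /= (unsplitK (inr i)); congr (_ + _ + _).
  by apply: eq_bigr => j _; rewrite col_mxEd.
rewrite [X in X + _]big1 ?add0r => [|k _]; last first.
  by rewrite block_mxEdl mxE /rscale scale0r.
by apply: eq_bigr => k _; rewrite block_mxEdr ffunE.
Qed.

Lemma pp_bigcap (alpha : {fset set Mn}) :
  (forall A, A \in alpha -> pp_set A) ->
  pp_set (\bigcap_(A in [set` alpha]) A).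
Proof.
rewrite bigcap_fset => ppalpha; rewrite big_seq.
by apply: big_ind => //; [exact: pp_setT | exact: pp_setI].
Qed.

End PPSets.

(** * Euler characteristics as alternating sums over faces *)

Section EulerCharacteristic.
Variable V : choiceType.
Implicit Types (K : {fset {fset V}}) (T F : {fset V}).

(** After exchanging the sums, each face is counted once, at one below its cardinality. The right
    side would count the empty set as [1], the left side omits it. *)
Lemma simplicial_euler_charE K : fset0 \notin K ->
  simplicial_euler_char K = \sum_(F <- K) (-1) ^+ #|` F|.-1.
Proof.
move=> K0; rewrite /simplicial_euler_char; set m := \max_(_ <- _) _.
transitivity (\sum_(0 <= k < m) \sum_(F <- K)
    if #|` F| == k.+1 then (-1) ^+ k else 0 : int).
  apply: eq_bigr => k _; rewrite -big_mkcond big_const_seq.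
  rewrite iter_addr_0 -mulr_natr natz; congr (_ * _%:Z).
  rewrite -size_filter; apply: perm_size; apply: uniq_perm => //.
    exact/filter_uniq/fset_uniq.
  by move=> F; rewrite mem_filter !inE andbC.
rewrite exchange_big /= [LHS]big_seq [RHS]big_seq; apply: eq_bigr => F FK.
have F0 : (0 < #|` F|)%N.
  by rewrite cardfs_gt0; apply: contraNneq K0 => <-.
have Fm : (#|` F|.-1 < m)%N.
  by rewrite prednK // /m (bigmaxn_sup_seq F).
rewrite big_mkord (bigD1 (Ordinal Fm)) //= prednK // eqxx big1 ?addr0 // => k kF.
case: eqP => // Fk; case/eqP: kF.
by apply: val_inj; rewrite /= Fk.
Qed.

(** Toggling a fixed [x] of [T] is a sign-reversing involution on subsets, so the sum equals its own
    negative. *)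
Lemma alternating_sum_fpowerset T : T != fset0 ->
  \sum_(F <- fpowerset T) (-1) ^+ #|` F| = 0 :> int.
Proof.
case/fset0Pn => x xT; set s := LHS.
pose h F := if x \in F then (F `\ x)%fset else (x |` F)%fset.
have hK : involutive h.
  move=> F; rewrite /h; have [xF|xF] := boolP (x \in F).
    by rewrite fsetD11 fsetD1K.
  by rewrite fset1U1 fsetU1K.
have hT F : (h F \in fpowerset T) = (F \in fpowerset T).
  rewrite !fpowersetE /h; case: ifP => xF.
    by rewrite -{2}(fsetD1K xF) fsubUset fsub1set xT.
  by rewrite fsubUset fsub1set xT.
suff: s = - s by move/eqP; rewrite -addr_eq0 -mulr2n Num.Theory.mulrn_eq0 => /eqP.
rewrite {1}/s (perm_big [seq h F | F <- fpowerset T]) /=; last first.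
  apply: uniq_perm; rewrite ?map_inj_uniq ?fset_uniq //; first exact: inv_inj.
  by move=> F; rewrite -{2}(hK F) (mem_map (inv_inj hK)) hT.
rewrite big_map -sumrN; apply: eq_bigr => F _; rewrite /h.
case: ifP => xF; last by rewrite cardfsU1 xF exprS mulN1r.
by rewrite [in RHS](cardfsD1 x F) xF exprS mulN1r opprK.
Qed.

(** A full simplex has Euler characteristic 1: the empty set is split off from the vanishing
    alternating sum and the remaining signs are flipped. *)
Lemma euler_char_fpowerset T :
  \sum_(F <- fpowerset T | F != fset0) (-1) ^+ #|` F|.-1 = (T != fset0)%:R :> int.
Proof.
have [->|T0] := eqVneq T fset0.
  by rewrite fpowerset0 big_seq_cond big1 // => F; rewrite inE => /andP[->].
have := alternating_sum_fpowerset T0.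
have T0P : fset0 \in fpowerset T by rewrite fpowersetE fsub0set.
rewrite (big_fsetD1 fset0) //= expr0 => /eqP.
rewrite addr_eq0 => /eqP T1.
rewrite [RHS]T1.
rewrite big_mkcond (big_fsetD1 fset0) //= add0r -sumrN.
rewrite [LHS]big_seq [RHS]big_seq; apply: eq_bigr => F.
rewrite !inE => /andP[F0 _]; rewrite F0; move: F0; rewrite -cardfs_gt0.
by case: #|` F| => // d _; rewrite exprS mulN1r opprK.
Qed.

End EulerCharacteristic.

(** * Moebius inversion over a finite family of sets *)

Section MobiusInversion.
Variable T : Type.
Implicit Types (F N : {fset set T}) (A B P Q : set T).

(** Among the members above [A], one with the most members of [F] below it is maximal: a strictly
    larger one would also have itself below it. *)
Lemma fset_set_maximal F A : A \in F ->
  exists2 B, B \in F & A `<=` B /\ forall C, C \in F -> B `<=` C -> B = C.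
Proof.
move=> AF; pose below B := [fset C in F | `[< (C `<=` B)%classic >]]%fset.
pose card_above k := `[< exists2 B, B \in F & A `<=` B /\ #|` below B| = k >].
have ex_above : exists k, card_above k.
  by exists #|` below A|; apply/asboolP; exists A => //; split.
have bound k : card_above k -> (k <= #|` F|)%N.
  move=> /asboolP[B _ [_ <-]]; apply: fsubset_leq_card.
  by apply/fsubsetP => C; rewrite !inE => /andP[].
case: (ex_maxnP ex_above bound) => k /asboolP[B BF [AB Bk]] kmax.
exists B => //; split=> // C CF BC; apply/seteqP; split=> //.
have sBC : (below B `<=` below C)%fset.
  apply/fsubsetP => Q; rewrite !inE => /andP[-> /asboolP QB].
  by apply/asboolP => x /QB/BC.
have : below B == below C.
  rewrite eqEfcard sBC Bk kmax //; apply/asboolP; exists C => //.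
  by split=> // x /AB/BC.
move=> /eqP/fsetP/(_ C); rewrite !inE CF /= => CB.
by apply/asboolP; rewrite CB; apply/asboolP.
Qed.

(** Induction removes a maximal [B]. No other member contains [B], so the value of [g] at [B] enters
    only the equation at [B], which determines it. *)
Lemma mobius_inversion F (f : set T -> int) : exists g : set T -> int,
  forall Q, Q \in F -> f Q = \sum_(P <- F | `[< P `<=` Q >]) g P.
Proof.
have [m] := ubnP #|` F|; elim: m F => // m IHm F.
have [->|/fset0Pn[A /fset_set_maximal[B BF [_ Bmax]]] Fm] := eqVneq F fset0.
  by exists f => Q; rewrite inE.
have [|g gF] := IHm (F `\ B)%fset; first by move: Fm; rewrite (cardfsD1 B) BF.
pose h := f B - \sum_(P <- (F `\ B)%fset | `[< P `<=` B >]) g P.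
exists (fun P => if P == B then h else g P) => Q QF.
have sumE : \sum_(P <- (F `\ B)%fset | `[< P `<=` Q >])
      (if P == B then h else g P) =
    \sum_(P <- (F `\ B)%fset | `[< P `<=` Q >]) g P.
  rewrite big_seq_cond [RHS]big_seq_cond; apply: eq_bigr => P.
  by rewrite !inE => /andP[/andP[/negPf->]].
rewrite big_mkcond (big_fsetD1 B) //= -big_mkcond sumE /= eqxx.
have [->|QB] := eqVneq Q B; first by rewrite asboolT // subrK.
rewrite asboolF ?add0r; first by apply: gF; rewrite !inE QB.
by move=> /(Bmax _ QF) BQ; rewrite BQ eqxx in QB.
Qed.

(** After exchanging the sums, the [gamma] that contribute for a given [P] are the nonempty subsets
    of the set [S] of members containing [P]; their signs add up to 1 if [S] is nonempty and to 0
    otherwise. *)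
Lemma euler_sum_mobius N F (f g : set T -> int) :
  (forall gamma, gamma \in fpowerset N ->
     f (\bigcap_(A in [set` gamma]) A) =
     \sum_(P <- F | `[< P `<=` \bigcap_(A in [set` gamma]) A >]) g P) ->
  \sum_(gamma <- fpowerset N | gamma != fset0)
     (-1) ^+ #|` gamma|.-1 * f (\bigcap_(A in [set` gamma]) A) =
  \sum_(P <- F) `[< exists2 A, A \in N & P `<=` A >]%:R * g P.
Proof.
move=> fg; transitivity (\sum_(gamma <- fpowerset N | gamma != fset0)
   \sum_(P <- F | `[< P `<=` \bigcap_(A in [set` gamma]) A >])
     (-1) ^+ #|` gamma|.-1 * g P).
  rewrite big_seq_cond [RHS]big_seq_cond; apply: eq_bigr => gamma /andP[gN _].
  by rewrite fg // mulr_sumr.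
rewrite (exchange_big_dep xpredT) //=; apply: eq_bigr => P _.
rewrite -mulr_suml; congr (_ * _).
pose S := [fset A in N | `[< (P `<=` A)%classic >]]%fset.
rewrite (_ : `[< _ >] = (S != fset0)); last first.
  apply/asboolP/fset0Pn => [[A AN PA]|[A]].
    by exists A; rewrite !inE AN; apply/asboolP.
  by rewrite !inE => /andP[AN /asboolP PA]; exists A.
rewrite -euler_char_fpowerset; apply: eq_fbig_cond => // gamma.
rewrite !inE !fpowersetE; case: eqP => /= _; rewrite ?andbF ?andbT //.
apply/andP/fsubsetP => [[/fsubsetP gN /asboolP Pg] A Ag|gS].
  by rewrite !inE gN //; apply/asboolP => x /Pg; apply.
split; first by apply/fsubsetP => A /gS; rewrite !inE => /andP[].
apply/asboolP => x Px A /gS; rewrite !inE => /andP[_ /asboolP]; exact.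
Qed.

End MobiusInversion.

(** * Join, meet and local complexes of antichains *)

Section LocalCharacteristic.
Variables (R : pzRingType) (M : lmodType R^c) (n : nat).
Local Notation Mn := {ffun 'I_n -> M}.
Implicit Types (A B P : set Mn) (alpha beta gamma : {fset set Mn}).

(** Keeping only the maximal members leaves the union unchanged, since every member lies in a
    maximal one. *)
Lemma pp_antichain_reduction alpha :
  (forall A, A \in alpha -> pp_set A /\ A !=set0) ->
  exists gamma, pp_antichain gamma /\ pp_union gamma = pp_union alpha.
Proof.
move=> ppalpha.
pose gamma := [fset A in alpha |
  `[< forall B, B \in alpha -> (A `<=` B)%classic -> A = B >]]%fset.
exists gamma; split; first split=> [A|A B].
- by rewrite !inE => /andP[/ppalpha].
- by rewrite !inE => /andP[_ /asboolP Amax] /andP[/Amax].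
apply/seteqP; split=> x [A /=].
  by rewrite !inE => /andP[Aalpha _] Ax; exists A.
move=> /fset_set_maximal[B Balpha [AB Bmax]] Ax.
by exists B; [rewrite /= !inE Balpha; apply/asboolP | apply: AB].
Qed.

Lemma pp_joinP alpha beta : pp_antichain alpha -> pp_antichain beta ->
  pp_antichain (pp_join alpha beta) /\
  pp_union (pp_join alpha beta) = pp_union alpha `|` pp_union beta.
Proof.
move=> [ppa _] [ppb _]; have [A|gamma [ppg gammaE]] :=
    @pp_antichain_reduction (alpha `|` beta)%fset.
  by rewrite inE => /orP[/ppa|/ppb].
rewrite /pp_join; case: xgetP => [//|/(_ gamma)[]]; split=> //.
by rewrite gammaE /pp_union set_fsetU bigcup_setU.
Qed.

Lemma pp_meetP alpha beta : pp_antichain alpha -> pp_antichain beta ->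
  pp_antichain (pp_meet alpha beta) /\
  pp_union (pp_meet alpha beta) = pp_union alpha `&` pp_union beta.
Proof.
move=> [ppa _] [ppb _].
(* By distributivity the pairwise intersections have the required union; empty ones are dropped
   because members of an antichain are nonempty. *)
pose G := [fset C in [fset (A `&` B)%classic | A in alpha, B in beta]
  | `[< (C !=set0)%classic >]]%fset.
have [C|gamma [ppg gammaE]] := @pp_antichain_reduction G.
  rewrite !inE => /andP[/imfset2P[A Aa [B Bb ->]] /asboolP nAB].
  by split=> //; apply: pp_setI; [have [] := ppa A Aa | have [] := ppb B Bb].
rewrite /pp_meet; case: xgetP => [//|/(_ gamma)[]]; split=> //.
rewrite gammaE; apply/seteqP; split=> [x [C /=]|x [[A Aa Ax] [B Bb Bx]]].
  rewrite !inE => /andP[/imfset2P[A Aa [B Bb ->]] _] [Ax Bx].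
  by split; [exists A | exists B].
exists (A `&` B) => //=; rewrite !inE; apply/andP; split.
  by apply/imfset2P; exists A => //; exists B.
by apply/asboolP; exists x.
Qed.

(** The excluded vertex [[set a]] may be readmitted: a [gamma] containing it has finite intersection
    and contributes zero. *)
Lemma euler_local_complexE a alpha :
  simplicial_euler_char (local_complex a alpha) =
  \sum_(gamma <- fpowerset (members_at a alpha) | gamma != fset0)
    (-1) ^+ #|` gamma|.-1 *
    `[< infinite_set (\bigcap_(A in [set` gamma]) A) >]%:R.
Proof.
rewrite simplicial_euler_charE; last by rewrite !inE eqxx andbF.
rewrite [RHS](eq_bigr (fun gamma =>
    if `[< infinite_set (\bigcap_(A in [set` gamma]) A) >]
    then (-1) ^+ #|` gamma|.-1 else 0)); last first.
  by move=> gamma _; case: asbool; rewrite ?mulr1 ?mulr0.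
rewrite -big_mkcondr; apply: eq_fbig_cond => // gamma.
rewrite !inE andbT !fpowersetCE fpowersetE -!andbA.
case: (gamma `<=` _)%fset => //=; rewrite andb_idl // => /andP[_ /asboolP ginf].
apply/fdisjointP => A Ag; rewrite inE; apply/eqP => Aa; apply: ginf.
apply: (@sub_finite_set _ _ [set a]) => // x; rewrite -Aa; exact.
Qed.

(** [F] consists of all intersections of subfamilies of [N]. As [F] and [g] depend only on [N] and
    [a], the same weights serve several antichains. A member containing [P] passes through [a]
    because [P] does. *)
Lemma euler_local_complex_indicator (hM : theory_eq_aleph0 M) a
    (N : {fset set Mn}) :
  (forall A, A \in N -> pp_set A /\ A a) ->
  exists (F : {fset set Mn}) (g : set Mn -> int),
    (forall P, P \in F -> pp_set P /\ P a) /\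
    forall alpha, (forall A, A \in alpha -> pp_set A) ->
      (members_at a alpha `<=` N)%fset ->
      simplicial_euler_char (local_complex a alpha) =
      \sum_(P <- F) `[< P `<=` pp_union alpha >]%:R * g P.
Proof.
move=> ppN.
pose F : {fset set Mn} :=
  [fset (\bigcap_(A in [set` (gamma : {fset set Mn})]) A)%classic
    | gamma in fpowerset N]%fset.
have ppF P : P \in F -> pp_set P /\ P a.
  move=> /imfsetP[gamma /=]; rewrite fpowersetE => /fsubsetP gN ->.
  by split=> [|A /= /gN/ppN[] //]; apply: pp_bigcap => A /gN/ppN[].
have [g gF] := mobius_inversion F (fun P => `[< infinite_set P >]%:R).
exists F, g; split=> // alpha ppalpha alphaN; rewrite euler_local_complexE.
rewrite (@euler_sum_mobius _ _ F (fun P => `[< infinite_set P >]%:R) g).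
  rewrite [LHS]big_seq [RHS]big_seq; apply: eq_bigr => P /ppF[ppP Pa].
  congr (_%:R * _); congr nat_of_bool; apply: asbool_equiv_eq; split.
    by move=> [A]; rewrite !inE => /andP[Aalpha _] PA x /PA Ax; exists A.
  have P0 : P !=set0 by exists a.
  move=> /(pp_set_prime hM ppP P0 ppalpha)[A Aalpha PA]; exists A => //.
  by rewrite !inE Aalpha; apply/asboolP/PA.
move=> gamma; rewrite fpowersetE => gammaN; apply: gF; apply/imfsetP.
by exists gamma => //=; rewrite fpowersetE (fsubset_trans gammaN).
Qed.

End LocalCharacteristic.

(** * Termwise comparison of the four local characteristics *)

Theorem theorem3p2p10 (R : pzRingType) (M : lmodType R^c)
    (hM : theory_eq_aleph0 M) (n : nat) (hn : (0 < n)%N)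
    (a : {ffun 'I_n -> M}) (alpha beta : {fset set {ffun 'I_n -> M}})
    (halpha : pp_antichain alpha) (hbeta : pp_antichain beta) :
  local_char a (pp_join alpha beta) + local_char a (pp_meet alpha beta) =
  local_char a alpha + local_char a beta.
Proof.
have [] := (pp_joinP halpha hbeta, pp_meetP halpha hbeta).
move: (pp_join _ _) (pp_meet _ _) => join meet [[ppj _] jE] [[ppm _] mE].
have [[ppa _] [ppb _]] := (halpha, hbeta).
(* One family covering all four antichains gives them common weights. *)
have [A|F [g [ppF chiE]]] := @euler_local_complex_indicator _ _ _ hM a
    (members_at a (alpha `|` beta `|` join `|` meet))%fset.
  rewrite !inE -!orbA => /andP[Aabjm /asboolP Aa]; split=> //.
  by case/or4P: Aabjm => [/ppa|/ppb|/ppj|/ppm] [].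
have sub gamma : (gamma `<=` alpha `|` beta `|` join `|` meet)%fset ->
    (members_at a gamma `<=` members_at a (alpha `|` beta `|` join `|` meet))%fset.
  move=> /fsubsetP gU; apply/fsubsetP => A; rewrite !inE /= => /andP[/gU Ag ->].
  by move: Ag; rewrite !inE andbT.
have deltaE : delta join a + delta meet a = delta alpha a + delta beta a.
  by rewrite /delta jE mE asbool_or asbool_and; do 2!case: asbool.
rewrite /local_char addrACA [RHS]addrACA -!opprD deltaE; congr (_ - _).
rewrite !chiE; try by [move=> A /ppa[]|move=> A /ppb[]|move=> A /ppj[]
  |move=> A /ppm[]|apply: sub; apply/fsubsetP => A; rewrite !inE => ->; rewrite ?orbT].
rewrite -!big_split [LHS]big_seq [RHS]big_seq; apply: eq_bigr => P /ppF[ppP Pa] /=.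
rewrite -!mulrDl; congr (_ * _).
have P0 : P !=set0 by exists a.
have -> : `[< P `<=` pp_union join >] =
    `[< P `<=` pp_union alpha >] || `[< P `<=` pp_union beta >].
  rewrite -asbool_or; apply: asbool_equiv_eq; rewrite jE.
  split=> [Pab|[Pa'|Pb'] x Px]; [|by left; apply: Pa'|by right; apply: Pb'].
  (* Primality places [P] inside a single member, which comes from [alpha] or from [beta]. *)
  have := @pp_set_prime _ _ _ hM P (alpha `|` beta)%fset ppP P0.
  rewrite /pp_union set_fsetU bigcup_setU => /(_ _ Pab)[A|A].
    by rewrite inE => /orP[/ppa|/ppb] [].
  by rewrite inE => /orP[Aa|Ab] PA; [left|right] => x /PA Ax; exists A.
have -> : `[< P `<=` pp_union meet >] =
    `[< P `<=` pp_union alpha >] && `[< P `<=` pp_union beta >].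
  by rewrite -asbool_and; apply: asbool_equiv_eq; rewrite mE subsetI.
(* For truth values, disjunction plus conjunction equals the sum of the two. *)
by do 2!case: asbool.
Qed.
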